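(* Let $G$ be a (finite) transitive permutation group of squarefree degree $n$ which is realised by a Hopf-Galois structure (of some type). Then $G$ has derived length at most $4$. In particular, $G$ is soluble.
   Context: All permutation groups are finite and transitive. A permutation group of degree $n$ is a group $G$ with an injective homomorphism $G\to\mathrm{Perm}(X)$, $|X|=n$; up to isomorphism it is $G$ acting by left multiplication $\lambda$ on $X=G/G'$, where $G'$ (the stabiliser of a point) is a subgroup of index $n$ with trivial core. Let $L/K$ be a finite separable field extension with normal closure $E$. A Hopf-Galois structure on $L/K$ consists of a cocommutative $K$-Hopf algebra $H$ together with an action of $H$ on $L$ making $L$ an $H$-module algebra such that the $K$-linear map $L\otimes_K H\to \mathrm{End}_K(L)$, $x\otimes h\mapsto (y\mapsto x(h\cdot y))$, is bijective. By the theorem of Greither and Pareigis, with $\Gamma=\mathrm{Gal}(E/K)$, $\Gamma'=\mathrm{Gal}(E/L)$, $X=\Gamma/\Gamma'$, the Hopf-Galois structures on $L/K$ correspond bijectively to the regular subgroups $N$ of $\mathrm{Perm}(X)$ normalised by $\lambda(\Gamma)$; the isomorphism class of $N$ (a group of order $n=[L:K]$) is called the type of the structure. A separable extension $L/K$ realises the permutation group $G$ (with point stabiliser $G'$) if there is an isomorphism $G\to\mathrm{Gal}(E/K)$ taking $G'$ to $\mathrm{Gal}(E/L)$. $G$ is realised by a Hopf-Galois structure of type $N$ if an extension $L/K$ realising $G$ admits a Hopf-Galois structure of type $N$; equivalently, $\mathrm{Perm}(G/G')$ contains a regular subgroup isomorphic to $N$ and normalised by $\lambda(G)$. *)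

(* Defs.v *)
From HB Require Import structures.
From mathcomp Require Import all_boot all_order all_fingroup all_algebra.
From mathcomp Require Import all_solvable all_field.

Set Implicit Arguments.
Unset Strict Implicit.
Unset Printing Implicit Defensive.

Import GRing.Theory.
Local Open Scope ring_scope.

(* An element of U (x) V (resp. U (x) V (x) W) is presented by a finite list of
   pure tensors.  Two lists present the same element exactly when every
   bilinear (resp. trilinear) map, with values in any K-module, agrees on them:
   this is the universal property of the tensor product.  Everything below is
   stated up to [eq_tensor] and [eq_tensor3], so that a list stands for its
   class in the tensor product. *)

Definition eq_tensor (K : fieldType) (U V : lmodType K) (s t : seq (U * V)) :=
  forall (M : lmodType K) (b : U -> V -> M),
    (forall u, linear (fun v => b u v)) ->
    (forall v, linear (fun u => b u v)) ->
  \sum_(p <- s) b p.1 p.2 = \sum_(p <- t) b p.1 p.2.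

Definition eq_tensor3 (K : fieldType) (U V W : lmodType K)
    (s t : seq (U * V * W)) :=
  forall (M : lmodType K) (b : U -> V -> W -> M),
    (forall u v, linear (fun w => b u v w)) ->
    (forall u w, linear (fun v => b u v w)) ->
    (forall v w, linear (fun u => b u v w)) ->
  \sum_(p <- s) b p.1.1 p.1.2 p.2 = \sum_(p <- t) b p.1.1 p.1.2 p.2.

(* [comul h] is a list of pairs (h_(1), h_(2)) with
   Delta(h) = \sum h_(1) (x) h_(2).  No finiteness of H over K is assumed. *)
Record hopfAlgebra (K : fieldType) := HopfAlgebra {
  hopf_alg :> algType K;
  comul : hopf_alg -> seq (hopf_alg * hopf_alg);
  counit : {lrmorphism hopf_alg -> K^o};
  antipode : {linear hopf_alg -> hopf_alg};
  comul_linear : forall (a : K) (g h : hopf_alg),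
    eq_tensor (comul (a *: g + h))
              ([seq (a *: p.1, p.2) | p <- comul g] ++ comul h);
  comul1 : eq_tensor (comul 1) [:: (1, 1)];
  comulM : forall g h : hopf_alg,
    eq_tensor (comul (g * h))
              [seq (p.1 * q.1, p.2 * q.2) | p <- comul g, q <- comul h];
  comulA : forall h : hopf_alg,
    eq_tensor3 [seq (q.1, q.2, p.2) | p <- comul h, q <- comul p.1]
               [seq (p.1, q.1, q.2) | p <- comul h, q <- comul p.2];
  counitl : forall h : hopf_alg, \sum_(p <- comul h) counit p.1 *: p.2 = h;
  counitr : forall h : hopf_alg, \sum_(p <- comul h) counit p.2 *: p.1 = h;
  antipodel : forall h : hopf_alg,
    \sum_(p <- comul h) antipode p.1 * p.2 = (counit h : K)%:A;
  antipoder : forall h : hopf_alg,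
    \sum_(p <- comul h) p.1 * antipode p.2 = (counit h : K)%:A
}.

Definition cocommutative (K : fieldType) (H : hopfAlgebra K) :=
  forall h : H, eq_tensor [seq (p.2, p.1) | p <- comul h] (comul h).

Record module_algebra (K : fieldType) (H : hopfAlgebra K) (L : algType K)
    (act : H -> L -> L) : Prop := ModuleAlgebra {
  act_linearl : forall y, linear (fun h => act h y);
  act_linearr : forall h, linear (act h);
  act1 : forall y, act 1 y = y;
  actM : forall g h y, act (g * h) y = act g (act h y);
  act_unit : forall h, act h 1 = (counit H h : K)%:A;
  act_mul : forall h x y,
    act h (x * y) = \sum_(p <- comul h) act p.1 x * act p.2 y
}.

(* The value at y of the image of \sum x (x) h under L (x) H -> End_K(L). *)
Definition galois_map (K : fieldType) (H : hopfAlgebra K) (L : algType K)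
    (act : H -> L -> L) (s : seq (L * H)) (y : L) : L :=
  \sum_(p <- s) p.1 * act p.2 y.

Record hopf_galois (K : fieldType) (L : fieldExtType K) (H : hopfAlgebra K)
    (act : H -> L -> L) : Prop := HopfGalois {
  hopf_galois_cocomm : cocommutative H;
  hopf_galois_module : module_algebra act;
  hopf_galois_inj : forall s t : seq (L * H),
    galois_map act s =1 galois_map act t -> eq_tensor s t;
  hopf_galois_surj : forall f : 'End(L),
    exists s : seq (L * H), galois_map act s =1 f
}.

Definition admits_hopf_galois (K : fieldType) (L : fieldExtType K) :=
  exists (H : hopfAlgebra K) (act : H -> L -> L), hopf_galois act.

(* [E : splittingFieldType K] is already normal over K, so "E is a normal
   closure of L" amounts to minimality. *)
Definition normal_closure (K : fieldType) (L : fieldExtType K)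
    (E : splittingFieldType K) (iota : 'AHom(L, E)) :=
  forall F : {subfield E},
    (limg iota <= F)%VS -> normalField 1 F -> F = {:E}%AS.

(* MathComp composes permutations and Galois automorphisms from left to right,
   so groups act on the right; since g |-> g^-1 identifies a group with its
   opposite and preserves subgroups, this is the usual notion. *)
Definition realises (gT : finGroupType) (G : {group gT}) (X : finType)
    (to : action G X) (x : X)
    (K : fieldType) (L : fieldExtType K) :=
  separable 1 {:L} /\
  exists (E : splittingFieldType K) (iota : 'AHom(L, E)),
    normal_closure iota /\
    exists f : {morphism G >-> gal_of {:E}},
      isom G 'Gal({:E} / 1) f /\
      (f @* 'C_G[x | to] = 'Gal({:E} / limg iota))%g.

Definition realised_by_hopf_galois (gT : finGroupType) (G : {group gT})
    (X : finType) (to : action G X) (x : X) :=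
  exists (K : fieldType) (L : fieldExtType K),
    realises to x L /\ admits_hopf_galois L.

Definition squarefree (n : nat) := forall d : nat, (d ^ 2 %| n)%N -> d = 1%N.

(* Main.v *)
From HB Require Import structures.
Require Import Defs.
From mathcomp Require Import all_boot all_order all_fingroup all_algebra.
From mathcomp Require Import all_solvable all_field.

Set Implicit Arguments.
Unset Strict Implicit.
Unset Printing Implicit Defensive.

(** Let E be the normal closure of L and let X be the set of embeddings of L
    into E, on which the Galois group, that is G, acts. Extending scalars to E,
    the algebra L becomes the algebra of E-valued functions on X, and an
    element h of H acts on it by a matrix with entries in E ([act_mx]). Such
    matrices multiply like the elements of H, their entries are compatible with
    the comultiplication ([act_mx_comul]), and applying a Galois automorphism
    to the entries amounts to permuting rows and columns.

    The bijectivity of the Galois map implies that a matrix in the E-span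
    of these matrices is determined by any one row, which may be prescribed
    arbitrarily ([span_mx_eq0], [span_mx_onto]). Fix a base point x in X. The
    element of the span whose row at x is the indicator of t is grouplike,
    which forces its entries to be idempotents, and hence its matrix to be that
    of a map from X to itself ([grouplike_idem], [grouplike_map_exists]). These
    maps form a regular group N of permutations of X, and N is normalised by G
    ([hopf_galois_regular], [greither_pareigis]).

    It remains to bound the derived length of a group J that normalises a
    regular group N of squarefree order. A group of squarefree order is soluble
    ([squarefree_sol], by transfer), so its Fitting subgroup F is cyclic and
    contains its own centraliser, and N is metabelian. The derived subgroup of
    J acts trivially on F and on N / F, and automorphisms with this property
    commute, so the second derived subgroup of J centralises N
    ([der2_norm_cent]). The centraliser of the regular group N acts freely on
    X, so its order is again squarefree and it is metabelian. Hence the fourth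
    derived subgroup of J is trivial ([der4_norm_regular]). *)

(** * Groups of squarefree order and their holomorphs *)

Section SquarefreeGroups.

Local Open Scope group_scope.

Lemma squarefree_dvd (m n : nat) : m %| n -> squarefree n -> squarefree m.
Proof. by move=> mn sqn d dm; apply: sqn; apply: dvdn_trans mn. Qed.

Lemma squarefree_pgroup_cyclic (gT : finGroupType) (p : nat) (P : {group gT}) :
  prime p -> p.-group P -> squarefree #|P| -> cyclic P.
Proof.
move=> p_pr pP sqP; have [k oP] := p_natP pP.
case: k oP => [|[|k]] oP.
- by rewrite (card1_trivg oP) cyclic1.
- by rewrite prime_cyclic // oP expn1.
have := sqP p; rewrite oP dvdn_exp2l // => /(_ isT) p1.
by rewrite p1 in p_pr.
Qed.

Lemma squarefree_Zgroup (gT : finGroupType) (G : {group gT}) :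
  squarefree #|G| -> Zgroup G.
Proof.
move=> sqG; apply/forall_inP=> V /SylowP[p p_pr sylV].
apply: squarefree_pgroup_cyclic p_pr (pHall_pgroup sylV) _.
exact: squarefree_dvd (cardSg (pHall_sub sylV)) sqG.
Qed.

(** Burnside's transfer argument. The transfer from G to P sends a generator g
    of P to the product of the elements x g^n x^-1 for x in a transversal.
    Each of them lies in P; unless it is trivial it generates P, so x
    normalises P, hence centralises it, and the factor is just g^n. The
    transfer of g is therefore g^|G : P|, which is not 1 since the index is
    prime to p: the kernel of the transfer is a proper subgroup. *)
Lemma Burnside_transfer_prime (gT : finGroupType) (G P : {group gT}) (p : nat) :
  prime p -> p.-Sylow(G) P -> #|P| = p -> 'N_G(P) \subset 'C(P) ->
  exists2 K : {group gT}, K <| G /\ K \proper G & abelian (G / K).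
Proof.
move=> p_pr sylP oP sNC; have sPG := pHall_sub sylP.
have idP : idm P @* P = P by apply: morphim_idm.
have cPP : abelian (idm P @* P).
  by rewrite idP cyclic_abelian // prime_cyclic ?oP.
pose V := transfer_morphism G cPP.
have abV : abelian (G / 'ker V).
  rewrite (isog_abelian (first_isog V)); apply/centsP=> a _ b _.
  exact: GRing.addrC.
exists ('ker V)%G => //; split; first exact: ker_normal.
have [g defP] := cyclicP (prime_cyclic (etrans (congr1 prime oP) p_pr)).
have Pg : g \in P by rewrite defP cycle_id.
have Gg := subsetP sPG g Pg.
rewrite properEneq (normal_sub (ker_normal V)) andbT; apply/eqP => kerG.
have Vg0 : V g = 1 by apply: mker; rewrite kerG.
pose X := transversal (rcosets P G :* <[g]>) G.
have trX : is_transversal X (rcosets P G :* <[g]>) G.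
  exact: transversalP (rcosets_cycle_partition sPG Gg).
have := transfer_cycle_expansion sPG cPP Gg trX.
rewrite -/(V g) Vg0 (eq_bigr (fun x =>
   GRing.natmul (FiniteModule.fmod cPP g) #|<[g]> : P :* x|)); last first.
  move=> x Xx; have Gx : x \in G := subsetP (transversal_sub trX) x Xx.
  set n := #|_ : _|.
  have Pgx : (g ^+ n) ^ x^-1 \in P.
    by rewrite conjgE invgK mulgA -mem_rcoset mulg_exp_card_rcosets.
  suff -> : (g ^+ n) ^ x^-1 = g ^+ n.
    rewrite /restrm /= FiniteModule.fmodX //.
    by rewrite /= idP.
  have [-> | gn1] := eqVneq (g ^+ n) 1; first by rewrite conj1g.
  have Pgn : g ^+ n \in P by rewrite groupX.
  have defPn : <[g ^+ n]> = P.
    apply/eqP; rewrite eqEcard cycle_subG Pgn /= oP -/#[_].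
    have : #[g ^+ n] %| p by rewrite -oP; apply: order_dvdG.
    case/primeP: p_pr => _ /[apply] /orP[|/eqP-> //].
    by rewrite order_eq1 (negPf gn1).
  have : x^-1 \in 'C(P).
    apply: (subsetP sNC); rewrite inE groupV Gx /=.
    by rewrite inE -{1}defPn -cycleJ cycle_subG.
  by move/centP => /(_ _ Pgn) cx; rewrite conjgE invgK -cx mulKVg.
rewrite GRing.sumrMnr (sum_index_rcosets_cycle sPG Gg trX).
have Pg' : g \in (idm P @* P)%G by rewrite /= idP.
rewrite -FiniteModule.fmodX // => /(congr1 val).
rewrite FiniteModule.fmodK ?groupX //= FiniteModule.fmval0 => /esym/eqP.
rewrite -order_dvdn /order -defP oP => p_dv.
have p'i : p^'.-nat #|G : P| by case/and3P: sylP.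
by move: p'i; rewrite p'natE // p_dv.
Qed.

(** For the smallest prime p dividing |G|, a Sylow p-subgroup P has order p and
    |Aut P| = p - 1 has no prime factor in common with |G|, so that P is
    central in its normaliser and the transfer yields an abelian quotient to
    induct on. *)
Lemma squarefree_sol (gT : finGroupType) (G : {group gT}) :
  squarefree #|G| -> solvable G.
Proof.
have [n] := ubnP #|G|; elim: n G => // n IHn G /ltnSE-leGn sqG.
have [->|ntG] := eqsVneq G 1; first exact: solvable1.
pose p := pdiv #|G|.
have p_pr : prime p by rewrite pdiv_prime // cardG_gt1.
have [P sylP] := Sylow_exists p G.
have sPG := pHall_sub sylP.
have oP : #|P| = p.
  rewrite (card_Hall sylP) p_part.
  have : 0 < logn p #|G| by rewrite logn_gt0 mem_primes p_pr cardG_gt0 pdiv_dvd.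
  case E: (logn p #|G|) => [|[|k]] // _.
  have := sqG p; rewrite pfactor_dvdn ?cardG_gt0 // E => /(_ isT) p1.
  by rewrite p1 in p_pr.
have sNC : 'N_G(P) \subset 'C(P).
  have cycP : cyclic P by rewrite prime_cyclic ?oP.
  have sNP : 'N_G(P) \subset 'N(P) by apply: subsetIr.
  rewrite -(ker_conj_aut P) -sub_morphim_pre // subG1 trivg_card1.
  set m := #|_|; apply: contraT => m_neq1.
  have m_gt1 : 1 < m by rewrite ltn_neqAle eq_sym m_neq1 cardG_gt0.
  have m_Aut : m %| p.-1.
    by rewrite -totient_prime // -oP -card_Aut_cyclic // cardSg // Aut_conj_aut.
  have m_G : m %| #|G|.
    exact: dvdn_trans (dvdn_morphim _ _) (cardSg (subsetIl _ _)).
  have: pdiv m <= p.-1.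
    apply: leq_trans (pdiv_leq (ltnW m_gt1)) (dvdn_leq _ m_Aut).
    by rewrite -subn1 subn_gt0 prime_gt1.
  rewrite leqNgt prednK ?prime_gt0 // => /negP[].
  by rewrite pdiv_min_dvd ?prime_gt1 ?pdiv_prime // (dvdn_trans (pdiv_dvd m)).
have [K [nsKG prKG] abGK] := Burnside_transfer_prime p_pr sylP oP sNC.
rewrite (series_sol nsKG) (abelian_sol abGK) andbT; apply: IHn.
  exact: leq_trans (proper_card prKG) leGn.
exact: squarefree_dvd (cardSg (normal_sub nsKG)) sqG.
Qed.

(** Writing C for the centraliser of the Fitting subgroup F, each derived
    subgroup of C lies in F, by descending induction: if D' is contained in F
    and D centralises F, then D is nilpotent of class at most 2 and normal, so
    D is contained in F. *)
Lemma cent_sub_Fitting (gT : finGroupType) (G : {group gT}) :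
  solvable G -> 'C_G('F(G)) \subset 'F(G).
Proof.
move=> solG; set C := 'C_G('F(G))%G.
have sCG : C \subset G by apply: subsetIl.
have nsCG : C <| G by rewrite /normal sCG normsI ?normG // norms_cent ?gFnorm.
have /derivedP[n Cn1] : solvable C := solvableS sCG solG.
suff sF k : k <= n -> C^`(n - k) \subset 'F(G).
  by have := sF n (leqnn n); rewrite subnn.
elim: k => [|k IHk] lekn; first by rewrite subn0 Cn1 sub1G.
have {IHk} := IHk (ltnW lekn); rewrite -(subnSK lekn) dergSn => sDF.
set D := C^`(n - k.+1)%G in sDF *.
have cDF : D \subset 'C('F(G)).
  exact: subset_trans (der_sub _ _) (subsetIr _ _).
apply: Fitting_max; first exact: gFnormal_trans.
apply/lcnP; exists 2; rewrite lcnSn lcn2; apply/commG1P.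
exact: subset_trans sDF (etrans (centsC _ _) cDF).
Qed.

Lemma squarefree_Fitting_cyclic (gT : finGroupType) (G : {group gT}) :
  squarefree #|G| -> cyclic 'F(G).
Proof.
move=> sqG; apply: nil_Zgroup_cyclic (Fitting_nil G).
exact: ZgroupS (Fitting_sub G) (squarefree_Zgroup sqG).
Qed.

(** The automorphism group of a cyclic group is abelian. *)
Lemma der1_cent_cyclic (gT : finGroupType) (F J : {group gT}) :
  cyclic F -> J \subset 'N(F) -> J^`(1) \subset 'C(F).
Proof.
move=> cycF nFJ; rewrite -(ker_conj_aut F).
rewrite -sub_morphim_pre ?(subset_trans (der_sub _ _)) //.
rewrite morphim_der // subG1; apply/eqP/derG1P.
exact: abelianS (Aut_conj_aut _ _) (Aut_cyclic_abelian cycF).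
Qed.

Lemma squarefree_metabelian (gT : finGroupType) (G : {group gT}) :
  squarefree #|G| -> G^`(2) = 1.
Proof.
move=> sqG; have cycF := squarefree_Fitting_cyclic sqG.
rewrite dergSn; apply/commG1P; apply: abelianS (cyclic_abelian cycF).
apply: subset_trans (cent_sub_Fitting (squarefree_sol sqG)).
by rewrite subsetI der_sub der1_cent_cyclic ?gFnorm.
Qed.

(** The automorphisms of N induced by J form a metabelian group, for the
    following reason. The derived subgroup J' acts trivially on the cyclic group
    F = 'F(N), and hence, by the three subgroups lemma, also on N / F because
    'C_N(F) is contained in F. Two such automorphisms commute, as the maps
    x |-> x^-1 x^a that determine them take values in the abelian group F; this
    is the three subgroups lemma again. *)
Lemma der2_norm_cent (gT : finGroupType) (N J : {group gT}) :
  squarefree #|N| -> J \subset 'N(N) -> J^`(2) \subset 'C(N).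
Proof.
move=> sqN nNJ; have cycF := squarefree_Fitting_cyclic sqN.
set F := 'F(N) in cycF *.
have nFJ : J \subset 'N(F) by apply: gFnorm_trans.
have cFJ1 : J^`(1) \subset 'C(F) by apply: der1_cent_cyclic.
have nNJ1 : J^`(1) \subset 'N(N) := subset_trans (der_sub _ _) nNJ.
have sF : [~: J^`(1), N] \subset F.
  apply: subset_trans (cent_sub_Fitting (squarefree_sol sqN)).
  rewrite subsetI commg_subr nNJ1 /=; apply/commG1P/three_subgroup.
    apply/commG1P; rewrite centsC (subset_trans cFJ1) // centS //.
    by rewrite commg_subr gFnorm.
  suff -> : [~: F, J^`(1)] = 1 by rewrite comm1G.
  by apply/commG1P; rewrite centsC.
apply/commG1P/three_subgroup; last rewrite (commGC N).
  by apply/commG1P; rewrite centsC (subset_trans cFJ1) ?centS.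
by apply/commG1P; rewrite centsC (subset_trans cFJ1) ?centS.
Qed.

(** The centraliser of a transitive group acts freely, so all of its orbits
    have as many points as it has elements. *)
Lemma card_cent_transitive_dvd (X : finType) (N : {group {perm X}}) :
  [transitive N, on [set: X] | 'P] -> #|'C(N)| %| #|X|.
Proof.
move=> trN; have actsC : [acts 'C(N), on [set: X] | 'P].
  by apply/actsP=> a _ y; rewrite !inE.
rewrite -cardsT -(acts_sum_card_orbit actsC).
rewrite (eq_bigr (fun _ => #|'C(N)|)) => [|_ /imsetP[y _ ->]].
  by rewrite sum_nat_const dvdn_mull.
rewrite card_in_imset // => a b Ca Cb eq_ab.
apply/permP=> z; have /= ab_y : a y = b y by exact: eq_ab.
have [c Nc ->] := atransP2 trN (in_setT y) (in_setT z).
rewrite /= /aperm -!permM -(centP Ca c Nc) -(centP Cb c Nc) !permM.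
by rewrite ab_y.
Qed.

(** The second derived subgroup of J centralises N, and the centraliser of N
    has squarefree order, hence is metabelian. Working with the centraliser
    avoids splitting the holomorph of N as a semidirect product. *)
Lemma der4_norm_regular (X : finType) (N J : {group {perm X}}) :
    squarefree #|X| -> #|N| = #|X| -> [transitive N, on [set: X] | 'P] ->
  J \subset 'N(N) -> J^`(4) = 1.
Proof.
move=> sqX oN trN nNJ; apply/trivgP.
have <- : 'C(N)^`(2) = 1.
  apply: squarefree_metabelian.
  exact: squarefree_dvd (card_cent_transitive_dvd trN) sqX.
by apply: (dergS 2 (der2_norm_cent _ nNJ)); rewrite oN.
Qed.

End SquarefreeGroups.

Import GRing.Theory.
Local Open Scope ring_scope.

(** * Embeddings of a separable extension into its normal closure *)

Lemma separable_ahom (K : fieldType) (L E : fieldExtType K)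
    (iota : 'AHom(L, E)) (a : L) :
  separable_element 1 a -> separable_element 1 (iota a).
Proof.
move=> sep_a; apply/separable_elementP; exists (map_poly iota (minPoly 1 a)).
split; last by rewrite separable_map.
  apply/polyOverP=> i; rewrite coef_map /= -(aimg1 iota) memv_img //.
  exact: (polyOverP (minPolyOver 1 a)).
by rewrite fmorph_root root_minPoly.
Qed.

(** A primitive element a of L over K is separable, so adjoining to K all the
    roots of the minimal polynomial of its image gives a Galois extension of K
    inside E that contains the image of L. By minimality it is all of E. *)
Lemma normal_closure_galois (K : fieldType) (L : fieldExtType K)
    (E : splittingFieldType K) (iota : 'AHom(L, E)) :
  separable 1 {:L} -> normal_closure iota -> galois 1 {:E}.
Proof.
move=> sepL closE; set a := separable_generator 1 {:L}.
have defL : {:L}%VS = <<1; a>>%VS.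
  exact: eq_adjoin_separable_generator (sub1v _).
have sep_ia : separable_element 1 (iota a).
  by apply: separable_ahom; exact: separable_generatorP.
have [r /eqP Dp] := splitting_field_normal 1%AS (iota a).
have galF : galois 1 <<1 & r>>.
  apply/splitting_galoisField; exists (minPoly 1 (iota a)).
  by split; [exact: minPolyOver | exact: sep_ia | exists r; rewrite ?Dp ?eqpxx].
suff /(congr1 (@asval _ _)) /= <- : <<1 & r>>%AS = {:E}%AS by [].
apply: closE; last by case/and3P: galF.
rewrite -[limg _]/(iota @: {:L})%VS defL aimg_adjoin aimg1.
apply/FadjoinP; split; first exact: sub1v.
by apply: seqv_sub_adjoin; rewrite -root_prod_XsubC -Dp root_minPoly.
Qed.

Section Embeddings.

Variables (K : fieldType) (L E : fieldExtType K) (X : finType).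
Variable emb : X -> 'AHom(L, E).
Hypothesis emb_inj : injective emb.

(** Dedekind's independence of embeddings, by the usual induction: a relation
    multiplied by one of the values emb x a, minus the relation at a * b, has
    a shorter support. *)
Lemma emb_independent_contra (P : pred X) (c : X -> E) (x : X) :
  P x -> c x != 0 -> exists a : L, \sum_(z | P z) c z * emb z a != 0.
Proof.
have [n] := ubnP #|P|; elim: n c x P => // n IHn c x P lePn Px nz_cx.
rewrite ltnS (cardD1x Px) in lePn; move/IHn: lePn => {n IHn}/=IH_P.
have [/eqfun_inP c_Px'_0 | ] := boolP [forall (y | P y && (y != x)), c y == 0].
  exists 1; rewrite (bigD1 x Px) /= rmorph1 mulr1.
  by rewrite big1 ?addr0 // => y /c_Px'_0->; rewrite mul0r.
case/forall_inPn => y Px'y nz_cy; have [Py neq_yx] := andP Px'y.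
have [a nz_yxa] : exists a, emb y a != emb x a.
  have : ~~ (ahval (emb y) == ahval (emb x)).
    by apply: contra neq_yx => /eqP/val_inj/emb_inj->.
  move/eqP=> neq; case: (pickP (fun j : 'I_(\dim {:L}) =>
    emb y (vbasis {:L})`_j != emb x (vbasis {:L})`_j)) => [j nz|eq0].
    by exists (vbasis {:L})`_j.
  case: neq; apply/lfunP=> v; rewrite (coord_vbasis (memvf v)) !linear_sum.
  by apply: eq_bigr => j _; rewrite !linearZ /=; have /negbFE/eqP-> := eq0 j.
pose d z := c z * (emb z a - emb x a).
have /IH_P[//|b nz_sumb]: d y != 0 by rewrite mulf_neq0 // subr_eq0.
have [sumb_0|] := eqVneq (\sum_(z | P z) c z * emb z b) 0; last by exists b.
exists (a * b).
rewrite -subr_eq0 -[z in _ - z](mulr0 (emb x a)) -[in z in _ - z]sumb_0.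
rewrite mulr_sumr -sumrB (bigD1 x Px) rmorphM /= mulrCA subrr add0r.
congr (_ != 0): nz_sumb; apply: eq_bigr => z _.
by rewrite mulrCA rmorphM -mulrBr -mulrBl mulrA.
Qed.

Lemma emb_independent (c : X -> E) :
  (forall y, \sum_z c z * emb z y = 0) -> forall z, c z = 0.
Proof.
move=> c0 z; apply: contraTeq isT => nz_cz.
have [a /eqP[]] := emb_independent_contra (erefl (predT z)) nz_cz.
exact: c0.
Qed.

Lemma emb_independent2 (c : X -> X -> E) :
    (forall u v, \sum_z \sum_w c z w * (emb z u * emb w v) = 0) ->
  forall z w, c z w = 0.
Proof.
move=> c0 z; apply: emb_independent => v; move: z; apply: emb_independent => u.
rewrite -[RHS](c0 u v); apply: eq_bigr => z _; rewrite mulr_suml.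
by apply: eq_bigr => w _; rewrite mulrAC mulrA.
Qed.

Hypothesis card_emb : #|X| = \dim {:L}.

(** When there are as many embeddings as the degree of L, they form an E-basis
    of the space of K-linear maps from L to E, and the square matrix of their
    values on a basis of L is invertible. *)
Definition emb_mx : 'M[E]_(#|X|, \dim {:L}) :=
  \matrix_(i, j) emb (enum_val i) (vbasis {:L})`_j.

Lemma emb_mx_full : row_full emb_mx.
Proof.
suff : row_free emb_mx by move=> /eqP eq_rk; rewrite /row_full eq_rk card_emb.
apply: inj_row_free => v v0; apply/rowP=> i; rewrite mxE.
rewrite -[i]enum_valK; move: (enum_val i) => {}i.
pose c z := v 0 (enum_rank z); rewrite -/(c i); move: i.
apply: emb_independent => y; rewrite (coord_vbasis (memvf y)).
under eq_bigr => z _.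
  rewrite linear_sum mulr_sumr.
  under eq_bigr => j _ do rewrite linearZ /= -scalerAr.
  over.
rewrite exchange_big big1 // => j _; rewrite -scaler_sumr.
suff -> : \sum_z c z * emb z (vbasis {:L})`_j = (v *m emb_mx) 0 j.
  by rewrite v0 mxE scaler0.
rewrite mxE (reindex (@enum_val X predT)); last exact: onW_bij (enum_val_bij _).
by apply: eq_bigr => k _; rewrite mxE /c enum_valK.
Qed.

Definition emb_coord (phi : L -> E) (z : X) : E :=
  (\row_j phi (vbasis {:L})`_j *m pinvmx emb_mx) 0 (enum_rank z).

Lemma emb_coordE (phi : L -> E) y :
  linear phi -> phi y = \sum_z emb_coord phi z * emb z y.
Proof.
move=> lin_phi; pose phiL : {linear L -> E} :=
  HB.pack phi (GRing.isLinear.Build _ _ _ _ phi lin_phi).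
rewrite -[phi]/(phiL : L -> E).
rewrite {1}(coord_vbasis (memvf y)) linear_sum.
under [RHS]eq_bigr => z _.
  rewrite {1}(coord_vbasis (memvf y)) linear_sum mulr_sumr.
  under eq_bigr => j _ do rewrite linearZ /= -scalerAr.
  over.
rewrite exchange_big; apply: eq_bigr => j _.
rewrite -scaler_sumr linearZ /=; congr (_ *: _).
pose v := \row_(j < \dim {:L}) phi (vbasis {:L})`_j.
transitivity (v 0 j); first by rewrite mxE.
rewrite -[v](@mulmxKpV _ _ _ _ _ emb_mx) ?submx_full ?emb_mx_full // mxE.
rewrite (reindex (@enum_val X predT)); last exact: onW_bij (enum_val_bij _).
by apply: eq_bigr => k _; rewrite [emb_mx k j]mxE /emb_coord enum_valK.
Qed.

Lemma emb_coord_uniq (phi : L -> E) (c : X -> E) :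
    linear phi -> (forall y, phi y = \sum_z c z * emb z y) ->
  emb_coord phi =1 c.
Proof.
move=> lin_phi phiE z; apply/eqP; rewrite -subr_eq0; apply/eqP; move: z.
apply: emb_independent => y; under eq_bigr => z _ do rewrite mulrBl.
by rewrite sumrB -phiE -emb_coordE ?subrr.
Qed.

End Embeddings.

(** * Grouplike elements of the Hopf algebra over the normal closure *)

(** Injectivity of the Galois map, transported to E. Multiplying the relation
    by an arbitrary c in E and taking the trace from E to sigma L gives a
    relation with coefficients in L, as the values of sigma are fixed by the
    Galois group of E over sigma L. By injectivity of the Galois map, it also
    holds with tau applied to the action. As c is arbitrary, independence of
    the automorphisms of E over sigma L recovers the original coefficients. *)
Lemma hopf_galois_relation (K : fieldType) (L : fieldExtType K)
    (E : splittingFieldType K) (H : hopfAlgebra K) (act : H -> L -> L)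
    (sigma tau : 'AHom(L, E)) (s : seq (E * H)) :
    galois 1 {:E} -> hopf_galois act ->
    (forall y, \sum_(p <- s) p.1 * sigma (act p.2 y) = 0) ->
  forall y, \sum_(p <- s) p.1 * tau (act p.2 y) = 0.
Proof.
move=> galE HG s0 y; pose M := limg sigma.
have galM : galois M {:E} by apply: galoisS galE; rewrite sub1v subvf.
pose Tr := galTrace M {:E}; pose phi (e : E) := (sigma^-1)%VF (Tr e).
have phiK e : sigma (phi e) = Tr e.
  by rewrite limg_lfunVK // mem_galTrace // memvf.
have fixM g u : g \in 'Gal({:E} / M)%g -> g (sigma u) = sigma u.
  by move=> Gg; apply: (fixed_gal (subvf M) Gg); rewrite memv_img ?memvf.
have Tr0 c : \sum_(p <- s) Tr (c * p.1) * tau (act p.2 y) = 0.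
  (* The relation with coefficients in L obtained from the trace. *)
  pose t := [seq (phi (c * p.1), p.2) | p <- s].
  have t0 : galois_map act t =1 galois_map act [::].
    move=> u; rewrite /galois_map big_nil big_map.
    apply: (fmorph_inj sigma); rewrite rmorph0 rmorph_sum /=.
    under eq_bigr => p _ do rewrite rmorphM /= phiK mulr_suml.
    rewrite exchange_big big1 // => g Gg.
    under eq_bigr => p _ do rewrite -(fixM g) // -rmorphM -mulrA.
    by rewrite -rmorph_sum -mulr_sumr s0 mulr0 rmorph0.
  have HGm := hopf_galois_module HG.
  pose b (u : L) (v : H) : E := sigma u * tau (act v y).
  have := hopf_galois_inj HG t0 (b := b); rewrite big_nil big_map /b /=.
  under eq_bigr => p _ do rewrite phiK.
  apply=> u a v w; rewrite /b; last by rewrite linearP mulrDl -scalerAl.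
  by rewrite (act_linearl HGm) linearP mulrDr -scalerAr.
pose d (g : gal_of {:E}) := \sum_(p <- s) g p.1 * tau (act p.2 y).
have /(_ 1%g) : forall g, g \in 'Gal({:E} / M)%g -> d g = 0.
  apply: gal_independent => c _; rewrite -[RHS](Tr0 c).
  under [RHS]eq_bigr => p _ do rewrite mulr_suml.
  rewrite exchange_big; apply: eq_bigr => g _; rewrite mulr_suml.
  by apply: eq_bigr => p _; rewrite rmorphM mulrC mulrA.
rewrite group1 => /(_ isT) d1; rewrite -[RHS]d1.
by apply: eq_bigr => p _; rewrite gal_id.
Qed.

Section HopfMatrices.

Variables (K : fieldType) (L : fieldExtType K) (E : splittingFieldType K).
Variables (H : hopfAlgebra K) (act : H -> L -> L).
Hypotheses (galE : galois 1 {:E}) (HG : hopf_galois act).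
Variables (X : finType) (emb : X -> 'AHom(L, E)).
Hypotheses (emb_inj : injective emb) (card_emb : #|X| = \dim {:L}).

Let HGm : module_algebra act := hopf_galois_module HG.

(** After extension of scalars to E, the algebra L becomes the algebra of
    functions on the set X of embeddings, and act_mx h is the matrix by which h
    acts on it. *)
Definition act_mx (h : H) (z w : X) : E :=
  emb_coord emb (fun y => emb z (act h y)) w.

Lemma linear_emb_act h z : linear (fun y => emb z (act h y)).
Proof. by move=> a u v; rewrite (act_linearr HGm) linearP. Qed.

Lemma act_mxE h z y : emb z (act h y) = \sum_w act_mx h z w * emb w y.
Proof. exact: (emb_coordE emb_inj card_emb y (linear_emb_act h z)). Qed.

Lemma act_mx_uniq h z (c : X -> E) :
    (forall y, emb z (act h y) = \sum_w c w * emb w y) ->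
  act_mx h z =1 c.
Proof. exact: (emb_coord_uniq emb_inj card_emb (linear_emb_act h z)). Qed.

Lemma act_mx1 z w : act_mx 1 z w = (w == z)%:R.
Proof.
move: w; apply: act_mx_uniq => y.
rewrite (Defs.act1 HGm) (bigD1 z) //= eqxx mul1r.
by rewrite big1 ?addr0 // => w' /negPf->; rewrite mul0r.
Qed.

Lemma act_mxM g h z w :
  act_mx (g * h) z w = \sum_t act_mx g z t * act_mx h t w.
Proof.
move: w; apply: act_mx_uniq => y; rewrite (Defs.actM HGm) act_mxE.
under eq_bigr => t _ do rewrite act_mxE mulr_sumr.
rewrite exchange_big; apply: eq_bigr => w _; rewrite mulr_suml.
by apply: eq_bigr => t _; rewrite mulrA.
Qed.

(** Compare the two expansions of emb z (act h (u * v)) in terms of products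
    of embeddings, which are linearly independent as functions of u and v. *)
Lemma act_mx_comul h z w w' :
  \sum_(p <- comul h) act_mx p.1 z w * act_mx p.2 z w' =
    (w == w')%:R * act_mx h z w.
Proof.
apply/eqP; rewrite -subr_eq0; apply/eqP; move: w w'.
apply: (emb_independent2 emb_inj) => u v.
under eq_bigr => w _.
  under eq_bigr => w' _ do rewrite mulrBl.
  rewrite sumrB.
  over.
rewrite sumrB; apply/eqP; rewrite subr_eq0; apply/eqP.
transitivity (emb z (act h (u * v))).
  rewrite (act_mul HGm) rmorph_sum /=.
  under [RHS]eq_bigr => p _ do
    rewrite rmorphM /= !act_mxE big_distrlr /=.
  rewrite [RHS]exchange_big; apply: eq_bigr => w _.
  rewrite [RHS]exchange_big; apply: eq_bigr => w' _.
  rewrite mulr_suml; apply: eq_bigr => p _.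
  by rewrite mulrACA.
rewrite act_mxE; apply: eq_bigr => w _.
rewrite (bigD1 w) //= eqxx mul1r rmorphM big1 ?addr0 // => w' /negPf.
by rewrite eq_sym => ->; rewrite !mul0r.
Qed.

(** The action of h on 1; the row sums are all equal because the counit takes
    its values in K. *)
Lemma sum_act_mx h z : \sum_w act_mx h z w = (counit H h : K)%:A.
Proof.
have := act_mxE h z 1; rewrite (act_unit HGm) linearZ rmorph1 /= => ->.
by apply: eq_bigr => w _; rewrite rmorph1 mulr1.
Qed.

Lemma act_mx_gal (g : {rmorphism E -> E}) (pi : {perm X}) h z w :
    (forall t y, emb (pi t) y = g (emb t y)) ->
  act_mx h (pi z) (pi w) = g (act_mx h z w).
Proof.
move=> gE; pose c t := g (act_mx h z ((pi^-1)%g t)).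
suff /(_ (pi w)) -> : act_mx h (pi z) =1 c by rewrite /c permK.
apply: act_mx_uniq => y; rewrite gE act_mxE rmorph_sum /=.
rewrite [RHS](reindex_inj (@perm_inj _ pi)) /=.
by apply: eq_bigr => t _; rewrite rmorphM /= /c permK gE.
Qed.

(** A list s of pairs (e, h) stands for an element of H extended to E, namely
    the sum of the tensors of e and h, and span_mx s is its matrix. *)
Definition span_mx (s : seq (E * H)) (z w : X) : E :=
  \sum_(p <- s) p.1 * act_mx p.2 z w.

Definition span_scale (a : E) (s : seq (E * H)) :=
  [seq (a * p.1, p.2) | p <- s].

Lemma span_mxE s z y :
  \sum_(p <- s) p.1 * emb z (act p.2 y) = \sum_w span_mx s z w * emb w y.
Proof.
under eq_bigr => p _ do rewrite act_mxE mulr_sumr.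
rewrite exchange_big; apply: eq_bigr => w _; rewrite mulr_suml.
by apply: eq_bigr => p _; rewrite mulrA.
Qed.

(** By linearity, a matrix in the span is determined by any one of its rows. *)
Lemma span_mx_eq0 s z z' :
  span_mx s z =1 (fun=> 0) -> span_mx s z' =1 (fun=> 0).
Proof.
move=> s0; apply: (emb_independent emb_inj) => y; rewrite -span_mxE; move: y.
apply: (hopf_galois_relation (sigma := emb z) (emb z') galE HG) => y.
by rewrite span_mxE big1 // => w _; rewrite s0 mul0r.
Qed.

Lemma span_mx_cat s t z w :
  span_mx (s ++ t) z w = span_mx s z w + span_mx t z w.
Proof. exact: big_cat. Qed.

Lemma span_mx_scale a s z w : span_mx (span_scale a s) z w = a * span_mx s z w.
Proof.
by rewrite /span_mx big_map mulr_sumr; apply: eq_bigr => p _; rewrite mulrA.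
Qed.

Lemma span_mx_lin (I : Type) (r : seq I) (a : I -> E)
    (s : I -> seq (E * H)) z w :
  span_mx (flatten [seq span_scale (a i) (s i) | i <- r]) z w =
    \sum_(i <- r) a i * span_mx (s i) z w.
Proof.
rewrite /span_mx big_flatten big_map; apply: eq_bigr => i _.
exact: span_mx_scale.
Qed.

(** Surjectivity of the Galois map: an E-linear combination of embeddings is
    determined by its values phi b_j on a basis of L, and the endomorphism of L
    which is the j-th coordinate function comes from a list s j. *)
Lemma span_mx_onto z (c : X -> E) : exists s, span_mx s z =1 c.
Proof.
pose b := vbasis {:L}.
have /fin_all_exists[s sE] (j : 'I_(\dim {:L})) :
    exists s, galois_map act s =1 (fun y => (coord b j y)%:A).
  have lin_f : linear (fun y : L => (coord b j y)%:A : L).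
    by move=> a u v; rewrite linearP scalerDl scalerA.
  pose f : {linear L -> L} := HB.pack (fun y : L => (coord b j y)%:A : L)
    (GRing.isLinear.Build _ _ _ _ _ lin_f).
  have [t tE] := hopf_galois_surj HG (linfun f).
  by exists t => y; rewrite tE lfunE.
pose phi y := \sum_w c w * emb w y.
exists (flatten [seq span_scale (phi b`_j) [seq (emb z p.1, p.2) | p <- s j]
  | j : 'I_(\dim {:L}) <- enum 'I_(\dim {:L})]).
move=> w; apply/eqP; rewrite -subr_eq0; apply/eqP; move: w.
apply: (emb_independent emb_inj) => y.
under eq_bigr => w _ do rewrite mulrBl.
rewrite sumrB; apply/eqP; rewrite subr_eq0 -/(phi y) -span_mxE; apply/eqP.
rewrite big_flatten big_map big_enum /=.
transitivity (\sum_j coord b j y *: phi b`_j).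
  apply: eq_bigr => j _; rewrite !big_map /=.
  transitivity (phi b`_j * emb z (galois_map act (s j) y)).
    rewrite /galois_map rmorph_sum mulr_sumr; apply: eq_bigr => p _.
    by rewrite rmorphM mulrA.
  rewrite sE.
  by rewrite linearZ rmorph1 -scalerAr mulr1.
rewrite {2}(coord_vbasis (memvf y)) /phi.
under eq_bigr => j _ do rewrite scaler_sumr.
rewrite exchange_big; apply: eq_bigr => w _ /=.
rewrite linear_sum mulr_sumr; apply: eq_bigr => j _.
by rewrite linearZ -scalerAr.
Qed.

Definition span_mul (s t : seq (E * H)) :=
  [seq (p.1 * q.1, p.2 * q.2) | p <- s, q <- t].

Lemma span_mx_mul s t z w :
  span_mx (span_mul s t) z w = \sum_v span_mx s z v * span_mx t v w.
Proof.
rewrite /span_mx big_allpairs_dep /=.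
under [RHS]eq_bigr => v _ do rewrite big_distrlr /=.
rewrite [RHS]exchange_big; apply: eq_bigr => p _.
rewrite [RHS]exchange_big; apply: eq_bigr => q _.
rewrite act_mxM mulr_sumr.
by apply: eq_bigr => v _; rewrite mulrACA.
Qed.

Definition span_map (g : E -> E) (s : seq (E * H)) :=
  [seq (g p.1, p.2) | p <- s].

Lemma span_mx_gal (g : {rmorphism E -> E}) (pi : {perm X}) s z w :
    (forall t y, emb (pi t) y = g (emb t y)) ->
  span_mx (span_map g s) (pi z) (pi w) = g (span_mx s z w).
Proof.
move=> gE; rewrite /span_mx big_map rmorph_sum; apply: eq_bigr => p _ /=.
by rewrite rmorphM (act_mx_gal _ _ _ gE).
Qed.

Lemma span_mx1 z w : span_mx [:: (1, 1)] z w = (w == z)%:R.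
Proof. by rewrite /span_mx big_seq1 mul1r act_mx1. Qed.

Lemma sum_span_mx s z z' : \sum_w span_mx s z w = \sum_w span_mx s z' w.
Proof.
suff eps v : \sum_w span_mx s v w = \sum_(p <- s) p.1 * (counit H p.2 : K)%:A.
  by rewrite !eps.
rewrite exchange_big; apply: eq_bigr => p _.
by rewrite -mulr_sumr sum_act_mx.
Qed.

(** By [span_mx_onto] and [span_mx_eq0], the E-span of the matrices of H is
    identified by its row at a base point x with the functions on X. So s t is
    the element of H extended to E that is dual to the idempotent at t of this
    algebra of functions, and it is the grouplike element attached to t. *)
Section Grouplike.

Variables (x : X) (s : X -> seq (E * H)).
Hypothesis sE : forall t, span_mx (s t) x =1 (fun w => (w == t)%:R).

Lemma span_mx_expand u z w :
  span_mx u z w = \sum_t span_mx u x t * span_mx (s t) z w.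
Proof.
(* The difference of the two sides, whose row at x vanishes. *)
pose v := u ++ flatten [seq span_scale (- span_mx u x t) (s t) | t <- enum X].
suff v0 : span_mx v z =1 (fun=> 0).
  have /eqP := v0 w; rewrite span_mx_cat span_mx_lin big_enum /=.
  rewrite addr_eq0 => /eqP->.
  by rewrite -sumrN; apply: eq_bigr => t _; rewrite mulNr opprK.
apply: (span_mx_eq0 (z := x)) => {}w.
rewrite span_mx_cat span_mx_lin big_enum /= (bigD1 w) //= sE eqxx mulr1.
by rewrite big1 ?addr0 ?subrr // => t /negPf neq; rewrite sE eq_sym neq mulr0.
Qed.

Lemma span_mx_row u t z w :
  span_mx u x =1 (fun v => (v == t)%:R) -> span_mx u z w = span_mx (s t) z w.
Proof.
move=> uE; rewrite span_mx_expand [RHS]span_mx_expand.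
by apply: eq_bigr => v _; rewrite uE sE.
Qed.

Lemma act_mx_expand h z w :
  act_mx h z w = \sum_t act_mx h x t * span_mx (s t) z w.
Proof.
have := span_mx_expand [:: (1, h)] z w.
rewrite {1}/span_mx big_seq1 mul1r => ->; apply: eq_bigr => t _.
by rewrite /span_mx big_seq1 mul1r.
Qed.

(** This expresses that s t is grouplike. Apply the comultiplication to s t and
    read off the entries (z, w) and (z, w') on its two tensor factors: by
    [act_mx_comul] at z one gets the right-hand side. Expand both factors
    in the basis given by the s a : by [act_mx_comul] at x, the coefficients
    form the matrix with a single nonzero entry, at (t, t), and one gets the
    left-hand side. *)
Lemma grouplike_idem t z w w' :
  span_mx (s t) z w * span_mx (s t) z w' = (w == w')%:R * span_mx (s t) z w.
Proof.
rewrite [in RHS]/span_mx mulr_sumr.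
under [RHS]eq_bigr => p _.
  rewrite mulrCA -act_mx_comul.
  under eq_bigr => q _.
    rewrite [X in X * _]act_mx_expand [X in _ * X]act_mx_expand.
    rewrite big_distrlr /=.
    over.
  rewrite exchange_big /= mulr_sumr.
  under eq_bigr => a _.
    rewrite exchange_big /= mulr_sumr.
    under eq_bigr => b _.
      under eq_bigr => q _ do rewrite mulrACA.
      rewrite -mulr_suml act_mx_comul.
      rewrite -mulrA mulrCA [p.1 * _]mulrA.
      over.
    over.
  over.
rewrite exchange_big /= (bigD1 t) //= [X in _ + X]big1 ?addr0; last first.
  move=> a /negPf neq; rewrite exchange_big big1 // => b _.
  rewrite -mulr_sumr -mulr_suml -/(span_mx (s t) x a) sE neq.
  by rewrite mul0r mulr0.
rewrite exchange_big (bigD1 t) //= [X in _ + X]big1 ?addr0; last first.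
  move=> b /negPf neq; rewrite big1 // => p _.
  by rewrite eq_sym neq !mul0r.
rewrite eqxx -mulr_sumr -mulr_suml -/(span_mx (s t) x t).
by rewrite sE eqxx !mul1r.
Qed.

Lemma grouplike_sum t z : \sum_w span_mx (s t) z w = 1.
Proof.
rewrite (sum_span_mx _ z x) (bigD1 t) //= sE eqxx big1 ?addr0 // => w.
by rewrite sE => /negPf->.
Qed.

(** Each row of the matrix of s t consists of orthogonal idempotents of the
    field E with sum 1, so exactly one entry is 1. *)
Lemma grouplike_map_exists : exists f : X -> X -> X,
  forall t z w, span_mx (s t) z w = (w == f t z)%:R.
Proof.
suff /fin_all_exists[f fE] t : exists g : X -> X,
    forall z w, span_mx (s t) z w = (w == g z)%:R by exists f.
suff /fin_all_exists[f fE] z : exists v : X,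
    forall w, span_mx (s t) z w = (w == v)%:R by exists f.
have [v nz_v | all0] := pickP (fun v => span_mx (s t) z v != 0); last first.
  have := grouplike_sum t z; rewrite big1 => [/esym/eqP|w _].
    by rewrite oner_eq0.
  by have /negbFE/eqP := all0 w.
have Nv : span_mx (s t) z v = 1.
  by apply: (mulfI nz_v); rewrite grouplike_idem eqxx mul1r mulr1.
exists v => w; have := grouplike_idem t z v w.
by rewrite Nv mul1r mulr1 eq_sym.
Qed.

End Grouplike.

(** The grouplike elements give maps f t : X -> X with f t x = t. They are
    determined by one value since a matrix in the span is determined by one
    row, hence they are closed under composition and under conjugation by
    permutations induced by automorphisms of E, and they are invertible: from
    f v t = x it follows that the composite of f t and f v fixes x, and so is
    the identity. *)
Theorem hopf_galois_regular (x : X) :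
  exists N : {group {perm X}},
    [/\ #|N| = #|X|, [transitive N, on [set: X] | 'P]%g
      & forall (g : {rmorphism E -> E}) (pi : {perm X}),
          (forall t y, emb (pi t) y = g (emb t y)) -> pi \in 'N(N)%g].
Proof.
have /fin_all_exists[s sE] t :
    exists u, span_mx u x =1 (fun w => (w == t)%:R).
  exact: span_mx_onto.
have [f fE] := grouplike_map_exists sE.
have one_bool (b : bool) : 1 = b%:R :> E -> b.
  by case: b => // /eqP; rewrite oner_eq0.
have fx t : f t x = t.
  by have := fE t x t; rewrite sE eqxx => /one_bool/eqP.
have f_uniq u (g : X -> X) :
    (forall z w, span_mx u z w = (w == g z)%:R) -> g =1 f (g x).
  move=> gE z; apply/eqP; have := gE z (g z).
  rewrite (span_mx_row sE z (g z) (gE x)) fE eqxx.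
  by move/esym/one_bool.
have f1 : f x =1 id.
  move=> z; symmetry; apply: (f_uniq [:: (1, 1)] id) => {}z w.
  exact: span_mx1.
have fM t t' : f t' \o f t =1 f (f t' t).
  move=> z; have -> : f t' t = (f t' \o f t) x by rewrite /= fx.
  apply: (f_uniq (span_mul (s t) (s t'))) => {}z w.
  rewrite span_mx_mul (bigD1 (f t z)) //= !fE eqxx mul1r.
  by rewrite big1 ?addr0 // => v /negPf neq; rewrite fE neq mul0r.
have f_free t t' z : f t z = f t' z -> t = t'.
  move=> eq_f; pose u := s t ++ span_scale (-1) (s t').
  have u0 : span_mx u z =1 (fun=> 0).
    by move=> w; rewrite span_mx_cat span_mx_scale !fE eq_f mulN1r subrr.
  have := span_mx_eq0 x u0 t.
  rewrite span_mx_cat span_mx_scale !sE eqxx mulN1r => /eqP.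
  by rewrite subr_eq0 => /eqP/one_bool/eqP.
have f_inj t : injective (f t).
  have /injF_onto onto : injective (fun v => f v t) by move=> v v' /f_free.
  have /codomP[v vE] := onto x.
  by apply: (can_inj (g := f v)) => z; have /= -> := fM t v z; rewrite -vE f1.
pose p t := perm (@f_inj t).
pose N := [set p t | t : X].
have groupN : group_set N.
  apply/group_setP; split.
    by apply/imsetP; exists x => //; apply/permP=> z; rewrite perm1 permE f1.
  move=> _ _ /imsetP[t _ ->] /imsetP[t' _ ->]; apply/imsetP.
  exists (f t' t) => //.
  by apply/permP=> z; rewrite permM !permE; apply: fM.
exists (group groupN); split=> /=.
- rewrite card_imset // => t t' /permP/(_ x).
  by rewrite !permE !fx.
- apply/imsetP; exists x => //; apply/setP=> z; rewrite inE; symmetry.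
  apply/imsetP; exists (p z); first exact: imset_f.
  by rewrite /= /aperm permE fx.
move=> g pi gE; rewrite inE; apply/subsetP=> _ /imsetP[_ /imsetP[t _ ->] ->].
pose h z := pi (f t ((pi^-1)%g z)).
have hE : h =1 f (h x).
  apply: (f_uniq (span_map g (s t))) => z w.
  rewrite -[z](permKV pi) -[w](permKV pi).
  rewrite (span_mx_gal _ _ _ gE) fE /h permK rmorph_nat.
  by rewrite (inj_eq perm_inj).
apply/imsetP; exists (h x) => //; apply/permP=> z.
by rewrite conjgE !permM [RHS]permE -hE /h; congr (pi _); rewrite permE.
Qed.

End HopfMatrices.

(** * From Hopf-Galois structures to regular subgroups *)

(** The half of the Greither-Pareigis theorem that produces N. The points of X
    index the embeddings of L into E : the image of x under a in G corresponds
    to the inclusion of L followed by the automorphism of E given by a. This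
    makes the actions of G on X and on E compatible. *)
Theorem greither_pareigis (gT : finGroupType) (G : {group gT}) (X : finType)
    (to : action G X) (x : X) :
    [transitive G, on [set: X] | to]%g -> realised_by_hopf_galois to x ->
  exists N : {group {perm X}},
    [/\ #|N| = #|X|, [transitive N, on [set: X] | 'P]%g
      & (actperm to @* G \subset 'N(N))%g].
Proof.
move=> trG [K [L [[sepL [E [iota [closE [f [isoGf fC]]]]]] [H [act HG]]]]].
have galE := normal_closure_galois sepL closE.
have [injf defGal] := isomP isoGf.
have /fin_all_exists2[rep Grep repE] z : exists2 g, g \in G & z = to x g.
  exact: atransP2in (subxx G) trG _ _ (in_setT x) (in_setT z).
pose emb z : 'AHom(L, E) := (f (rep z) \o iota)%AF.
have memC a : a \in G -> to x a = x <-> forall y, f a (iota y) = iota y.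
  move=> Ga; apply: (@iff_trans _ (a \in 'C_G[x | to]%g)).
    by rewrite !inE Ga sub1set inE; split=> /eqP.
  apply: (@iff_trans _ (f a \in 'Gal({:E} / limg iota)%g)).
    rewrite -fC /=; split=> [Ca | /morphimP[b Gb Cb eq_f]].
      exact: mem_morphim.
    by rewrite (injmP injf a b).
  rewrite gal_kHom ?subvf //; split=> [/kAHomP fix_a y | fix_a].
    by rewrite fix_a // memv_img ?memvf.
  by apply/kAHomP=> _ /memv_imgP[y _ ->].
have embE a y : a \in G -> emb (to x a) y = f a (iota y).
  move=> Ga; rewrite comp_lfunE /=; set b := rep _; have Gb : b \in G := Grep _.
  (* The points x b and x a agree, so b and a differ by a stabiliser element. *)
  have : to x (b * a^-1)%g = x by rewrite actMin ?groupV // -repE actKin.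
  move/memC => /(_ (groupM Gb (groupVr Ga)) y) fix_y.
  by rewrite -{1}(mulgKV a b) morphM ?groupM ?groupV // galM ?memvf // fix_y.
have emb_inj : injective emb.
  move=> z z' eq_emb; rewrite [z]repE [z']repE; set a := rep z; set b := rep z'.
  have [Ga Gb] : a \in G /\ b \in G by split; apply: Grep.
  have : to x (a * b^-1)%g = x.
    apply/memC=> [|y]; first by rewrite groupM ?groupV.
    rewrite morphM ?groupV // morphV // galM ?memvf //.
    have := congr1 (fun g : 'AHom(L, E) => g y) eq_emb.
    rewrite /= !comp_lfunE /= -/a -/b => ->.
    by rewrite -galM ?memvf // mulgV gal_id.
  rewrite actMin ?groupV // => eq_x; rewrite -{2}eq_x.
  by rewrite actKVin.
have card_emb : #|X| = \dim {:L}.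
  have galM : galois (limg iota) {:E}.
    by apply: galoisS galE; rewrite sub1v subvf.
  have <- : \dim (limg iota) = \dim {:L}.
    by rewrite limg_dim_eq // (eqP (AHom_lker0 iota)) capv0.
  rewrite -cardsT.
  have -> : [set: X] = orbit to G x.
    apply/setP=> z; rewrite inE; symmetry; rewrite [z]repE.
    by apply: mem_orbit.
  rewrite card_orbit_in // -divgS ?subsetIl //.
  rewrite -(card_injm injf (subxx G)) -(card_injm injf (subsetIl G _)).
  rewrite fC defGal.
  rewrite -!galois_dim // dimv1 divn1.
  have dv : (\dim (limg iota) %| \dim {:E})%N by apply: field_dimS (subvf _).
  rewrite -{1}(divnK dv) mulKn // divn_gt0 ?adim_gt0 //.
  exact: dvdn_leq (adim_gt0 _) dv.
have [N [oN trN nN]] := hopf_galois_regular galE HG emb_inj card_emb x.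
exists N; split=> //; apply/subsetP=> _ /morphimP[a _ Ga ->].
apply: (nN (f a)) => z y; rewrite actpermE //.
rewrite {1}[z]repE -actMin // embE ?groupM // morphM // galM ?memvf //.
by rewrite comp_lfunE.
Qed.

Theorem theorem3p3 (gT : finGroupType) (G : {group gT}) (X : finType)
    (to : action G X) (x : X)
    (G_faithful : [faithful G, on [set: X] | to])
    (G_transitive : [transitive G, on [set: X] | to])
    (squarefree_degree : squarefree #|X|)
    (G_realised : realised_by_hopf_galois to x) :
  (G^`(4) = 1)%g /\ solvable G.
Proof.
have [N [oN trN nN]] := greither_pareigis G_transitive G_realised.
suff G4 : (G^`(4) = 1)%g by split=> //; apply/derivedP; exists 4.
have injto : ('injm (actperm to))%g.
  rewrite ker_actperm; apply: subset_trans G_faithful.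
  by rewrite subsetI subxx subsetIl.
apply/eqP; rewrite -(morphim_injm_eq1 injto) ?der_sub // morphim_der //.
by apply/eqP; apply: der4_norm_regular nN.
Qed.
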